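(* Let $h:(\mathbb{C}^d,o)\to(\mathbb{C},o)$ be a nonzero germ of a holomorphic function whose Newton polytope has $r\ge1$ facets, and let $\nu_1,\ldots,\nu_r$ be the corresponding monomial valuations on $\mathcal{O}_{\mathbb{C}^d,o}$. For $\underline v\in\mathbb{Z}^r$ let $M(\underline v)=\{g\in\mathcal{O}_{\mathbb{C}^d,o}\mid\nu_j(g)\ge v_j,\ 1\le j\le r\}$. Then the Newton polytope of $h$ is bi-stellar if and only if for all $\underline{v_1},\underline{v_2}\in\mathbb{Z}^r$ one has $$\bigl(M(\underline{v_1})+(h)\bigr)\cap\bigl(M(\underline{v_2})+(h)\bigr)=M(\underline v)+(h),$$ where $\underline v$ is the tuple of the componentwise maxima of $\underline{v_1}$ and $\underline{v_2}$.
   Context: Write $h=\sum_{\underline k}a_{\underline k}\underline x^{\underline k}$, $\mathrm{supp}\,h=\{\underline k\mid a_{\underline k}\ne0\}$. The Newton polyhedron of $h$ at the origin is the convex hull of $\bigcup_{\underline k\in\mathrm{supp}\,h}(\underline k+\mathbb{R}^d_{\ge0})$; the Newton polytope of $h$ is its compact boundary (the union of its compact faces), and the facets of the Newton polytope are the compact $(d-1)$-dimensional faces. If the affine hyperplane through a compact facet $\tau$ has equation $a_1x_1+\cdots+a_dx_d=N_\tau$ with $(a_1,\ldots,a_d)$ a primitive vector of positive integers, the corresponding monomial valuation $\nu$ is given by $\nu(x_1^{m_1}\cdots x_d^{m_d})=a_1m_1+\cdots+a_dm_d$, and on a series by the minimum over the monomials in its support. A Newton polytope is called bi-stellar if every two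 facets of it have a non-empty intersection. *)

(* Defs.v *)
From HB Require Export structures.
From mathcomp Require Export all_boot all_order all_algebra.
From mathcomp Require Export complex.
From mathcomp Require Export all_classical all_reals all_analysis.

Set Implicit Arguments.
Unset Strict Implicit.
Unset Printing Implicit Defensive.

Export Order.TTheory GRing.Theory Num.Theory numFieldNormedType.Exports.

Local Open Scope classical_set_scope.
Local Open Scope ring_scope.

Notation multiindex d := {ffun 'I_d -> nat}.

Definition mdeg d (k : multiindex d) : nat := (\sum_i k i)%N.

(* A germ at the origin of C^d is represented by its Taylor series there, that
   is by the family of coefficients k |-> a_k, where C = R[i]. *)
Notation power_series R d := (multiindex d -> R[i]).

Definition supp (R : realType) d (f : power_series R d) : set (multiindex d) :=
  [set k | f k != 0].

(* O_{C^d,o}: the power series that converge absolutely on some polydisc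
   around the origin. *)
Definition germs (R : realType) d : set (power_series R d) :=
  [set f | exists2 rho : R, 0 < rho &
           summable [set: multiindex d]
             (fun k => (Normc.normc (f k) * rho ^+ mdeg k)%:E)].
Arguments germs : clear implicits.

(* Cauchy product: the index l runs over the multi-indices with l i <= k i for
   all i. *)
Definition cauchy_mul (R : realType) d (f g : power_series R d) : power_series R d :=
  fun k => \sum_(l : {dffun forall i : 'I_d, 'I_(k i).+1})
    f [ffun i => nat_of_ord (l i)] * g [ffun i => (k i - l i)%N].

Definition principal_ideal (R : realType) d (h : power_series R d) :
    set (power_series R d) :=
  [set cauchy_mul f h | f in germs R d].

Definition sum_set (V : nmodType) (A B : set V) : set V :=
  [set f + g | f in A & g in B].

Definition exponent_point (R : realType) d (k : multiindex d) : 'rV[R]_d :=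
  \row_i (k i)%:R.

Definition orthant (R : realType) d : set 'rV[R]_d :=
  [set x | forall i, 0 <= x 0 i].
Arguments orthant : clear implicits.

Definition convex_hull (R : realType) (E : lmodType R) (A : set E) : set E :=
  smallest (@convex_set R E) A.

Definition newton_polyhedron (R : realType) d (h : power_series R d) :
    set 'rV[R]_d :=
  convex_hull
    (\bigcup_(k in supp h) [set exponent_point R k + x | x in orthant R d]).

Definition dot (R : realType) d (c x : 'rV[R]_d) : R := \sum_i c 0 i * x 0 i.

(* c = 0 is allowed, so the polyhedron is a face of itself, as is set0. *)
Definition face (R : realType) d (P F : set 'rV[R]_d) : Prop :=
  exists (c : 'rV[R]_d) (b : R),
    (forall x, P x -> b <= dot c x) /\ F = P `&` [set x | dot c x = b].

Definition affinely_independent (R : realType) d n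
    (p : 'I_n.+1 -> 'rV[R]_d) : Prop :=
  row_free (\matrix_(i < n) (p (lift ord0 i) - p ord0)).

(* F contains n + 1, but not n + 2, affinely independent points. *)
Definition has_dim (R : realType) d (F : set 'rV[R]_d) (n : nat) : Prop :=
  (exists p : 'I_n.+1 -> 'rV[R]_d,
     (forall i, F (p i)) /\ affinely_independent p) /\
  ~ (exists p : 'I_n.+2 -> 'rV[R]_d,
     (forall i, F (p i)) /\ affinely_independent p).

(* The facets of the Newton polytope of h, i.e. of the union of the compact
   faces of the Newton polyhedron of h. *)
Definition newton_facets (R : realType) d (h : power_series R d) :
    set (set 'rV[R]_d) :=
  [set tau | [/\ face (newton_polyhedron h) tau, compact tau &
                 has_dim tau d.-1]].

Definition bi_stellar (R : realType) d (h : power_series R d) : Prop :=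
  forall tau1 tau2, newton_facets h tau1 -> newton_facets h tau2 ->
    tau1 `&` tau2 !=set0.

(* tau lies in a hyperplane a_1 x_1 + ... + a_d x_d = N with a a primitive
   vector of positive integers.  For a facet tau this hyperplane is the affine
   span of tau, so that a is uniquely determined by tau. *)
Definition primitive_normal (R : realType) d (tau : set 'rV[R]_d)
    (a : 'I_d -> nat) : Prop :=
  [/\ forall i, (0 < a i)%N, \big[gcdn/0%N]_i a i = 1%N &
      exists N : R, tau `<=` [set x | \sum_i (a i)%:R * x 0 i = N]].

(* The infimum is a minimum for f != 0, and +oo for f = 0. *)
Definition monomial_valuation (R : realType) d (a : 'I_d -> nat)
    (f : power_series R d) : \bar R :=
  ereal_inf [set ((\sum_i a i * k i)%N%:R)%:E | k in supp f].

Definition valuation_ideal (R : realType) d r (a : 'I_r -> 'I_d -> nat)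
    (v : 'I_r -> int) : set (power_series R d) :=
  [set g | germs R d g /\
           forall j, (((v j)%:~R)%:E <= monomial_valuation (a j) g)%E].
Arguments valuation_ideal : clear implicits.
Arguments valuation_ideal R {d r} a v.

(* Main.v *)
Require Import Defs.
From mathcomp Require Import ring lra zify.

(* Let N_j = nu_j(h), so that tau_j is the part of the Newton polyhedron on the
   hyperplane a_j . x = N_j, and tau_i and tau_j meet iff some monomial of h has
   weight N_i for a_i and weight N_j for a_j.

   If tau_1 and tau_2 do not meet, split h = g1 - g2, where g1 collects the
   monomials of a_1-weight > N_1, so that those of g2 have a_2-weight > N_2.
   Then g1 = g2 + h lies in the intersection for suitable v1 and v2; but
   g1 = g' + f h with nu_1(g') > N_1 and nu_2(g') > N_2 would give f(0) = 0 and
   f(0) = 1.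

   Conversely, let g1 + f1 h = g2 + f2 h with g1 in M(v1) and g2 in M(v2), so
   that f h = g1 - g2 for f = f2 - f1.  Cut f as A + B, where A consists of the
   monomials x^k with a_j . k + N_j >= v1_j for all j such that v1_j >= v2_j.
   Then g1 - A h = g2 + B h lies in M(v): otherwise some monomial of f violates
   the v1-bound for an index i and the v2-bound for an index j.  As tau_i and
   tau_j meet, the lowest part of f h for the bigrading (a_i, a_j) is the
   product of the lowest parts of f and h, so f h has a monomial violating both
   bounds, which can come neither from g1 nor from g2. *)

Set Implicit Arguments.
Unset Strict Implicit.
Unset Printing Implicit Defensive.

Local Open Scope classical_set_scope.
Local Open Scope ring_scope.

(** * Weights of multi-indices *)

Definition wt d (a : 'I_d -> nat) (k : multiindex d) : nat :=
  (\sum_i a i * k i)%N.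

Lemma wtD d (a : 'I_d -> nat) (k l : multiindex d) :
  wt a (k + l) = (wt a k + wt a l)%N.
Proof. by rewrite /wt -big_split; apply: eq_bigr => i _; rewrite ffunE mulnDr. Qed.

Lemma wt0 d (a : 'I_d -> nat) : wt a 0 = 0%N.
Proof. by rewrite /wt big1 // => i _; rewrite ffunE muln0. Qed.

Lemma leq_wt d (a : 'I_d -> nat) (k : multiindex d) i :
  (forall i, 0 < a i)%N -> (k i <= wt a k)%N.
Proof.
by move=> a_gt0; rewrite /wt (bigD1 i) //= (leq_trans _ (leq_addr _ _)) ?leq_pmull.
Qed.

Lemma mdegE d (k : multiindex d) : mdeg k = wt (fun=> 1%N) k.
Proof. by apply: eq_bigr => i _; rewrite mul1n. Qed.

(** * Products, supports and convergence of power series *)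

Section CauchyProduct.
Variables (R : realType) (d : nat).
Implicit Types (f g h : power_series R d) (k l m : multiindex d).

Lemma cauchy_mulBl f g h : cauchy_mul (f - g) h = cauchy_mul f h - cauchy_mul g h.
Proof.
apply/funext => k.
rewrite /cauchy_mul -[RHS]/(cauchy_mul f h k - cauchy_mul g h k) /cauchy_mul -sumrB.
by apply: eq_bigr => l _; rewrite -mulrBl.
Qed.

Lemma cauchy_mulDl f g h : cauchy_mul (f + g) h = cauchy_mul f h + cauchy_mul g h.
Proof. by rewrite -[in RHS](addrK g f) cauchy_mulBl subrK. Qed.

Lemma box_split k (l : {dffun forall i : 'I_d, 'I_(k i).+1}) :
  [ffun i => nat_of_ord (l i)] + [ffun i => (k i - l i)%N] = k.
Proof. by apply/ffunP => i; rewrite !ffunE; apply: subnKC; rewrite -ltnS. Qed.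

Lemma supp_cauchy_mul f g k : supp (cauchy_mul f g) k ->
  exists l m, [/\ supp f l, supp g m & l + m = k].
Proof.
move=> fg_k; apply: contrapT => no_lm; move: fg_k; apply/negP; rewrite negbK.
rewrite /cauchy_mul big1 // => l _; apply/eqP; rewrite mulf_eq0.
apply/negP => /negP; rewrite negb_or => /andP[fl gm].
by apply: no_lm; eexists; eexists; split; [exact: fl|exact: gm|exact: box_split].
Qed.

(** The coefficient at [l + m] sums over all decompositions of this exponent; when only one can
    contribute, nothing cancels. *)
Lemma cauchy_mul_single f g l m :
  (forall l' m', supp f l' -> supp g m' -> l' + m' = l + m -> l' = l) ->
  cauchy_mul f g (l + m) = f l * g m.
Proof.
move=> single; pose l0 : {dffun forall i : 'I_d, 'I_((l + m)%R i).+1} :=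
  [ffun i => (inord (l i) : 'I_((l + m)%R i).+1)].
have l0E i : l0 i = l i :> nat.
  have -> : l0 i = inord (l i) by exact: ffunE.
  by rewrite inordK // ltnS [X in (_ <= X)%N]ffunE leq_addr.
have loE : [ffun i => nat_of_ord (l0 i)] = l.
  by apply/ffunP => i; rewrite ffunE l0E.
rewrite /cauchy_mul (bigD1 l0) //= big1 ?addr0 => [|l' l'_neq].
  rewrite loE; congr (_ * g _).
  by apply/ffunP => i; rewrite ffunE l0E [X in (X - _)%N]ffunE; apply: addKn.
apply/eqP; rewrite mulf_eq0; apply/negP => /negP; rewrite negb_or => /andP[fl' gm'].
case/eqP: l'_neq; apply/ffunP => i; apply: val_inj.
rewrite /= l0E; have /ffunP/(_ i) := single _ _ fl' gm' (box_split l').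
by rewrite ffunE.
Qed.

Lemma suppD f g k : supp (f + g) k -> supp f k \/ supp g k.
Proof.
rewrite /supp /= -[(f + g) k]/(f k + g k).
by have [->|] := eqVneq (f k) 0; [rewrite add0r; right|left].
Qed.

Lemma suppN f : supp (- f) = supp f.
Proof. by apply/seteqP; split => k; rewrite /supp /= -[(- f) k]/(- f k) oppr_eq0. Qed.

Lemma suppB f g k : supp (f - g) k -> supp f k \/ supp g k.
Proof. by move/suppD; rewrite suppN. Qed.

Definition series_restrict (P : pred (multiindex d)) f : power_series R d :=
  fun k => if P k then f k else 0.

Lemma supp_restrict P f : supp (series_restrict P f) = [set k | P k /\ supp f k].
Proof.
apply/seteqP; split => k; rewrite /supp /series_restrict /=.
  by case: (P k) => //; rewrite eqxx.
by case=> ->.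
Qed.

Lemma restrictBE P f :
  series_restrict P f - f = - series_restrict (predC P) f.
Proof.
apply/funext => k; rewrite -[LHS]/(series_restrict P f k - f k).
rewrite -[RHS]/(- series_restrict (predC P) f k) /series_restrict /=.
by case: (P k); rewrite ?subrr ?sub0r ?oppr0.
Qed.

(** This reduces valuations to weights of monomials. For [g = 0] the infimum is +oo and the
    right-hand side is vacuous. *)
Lemma monomial_valuation_ge (a : 'I_d -> nat) (v : int) g :
  (v%:~R%:E <= monomial_valuation a g)%E <->
  forall k, supp g k -> v <= (wt a k)%:Z.
Proof.
split=> [v_le k gk|v_le].
  have : (v%:~R%:E <= ((wt a k)%:R : R)%:E)%E.
    by apply: (le_trans v_le); apply: ereal_inf_lbound; exists k.
  by rewrite lee_fin -[(wt a k)%:R]/((wt a k)%:Z%:~R) ler_int.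
apply: le_ereal_inf_tmp => _ [k gk <-].
by rewrite lee_fin -[X in _ <= X]/((wt a k)%:Z%:~R) ler_int v_le.
Qed.

Lemma normc_ge0 (z : R[i]) : 0 <= Normc.normc z.
Proof. by case: z => x y; exact: sqrtr_ge0. Qed.

Lemma normc_sum (I : Type) (r : seq I) (P : pred I) (F : I -> R[i]) :
  Normc.normc (\sum_(i <- r | P i) F i) <= \sum_(i <- r | P i) Normc.normc (F i).
Proof.
elim/big_ind2: _ => [|x a y b xa yb|//]; first by rewrite Normc.normc0.
by apply: le_trans (lerD xa yb); exact: le_normcD.
Qed.

Lemma sum_geometric_half n : \sum_(i < n) (2^-1 : R) ^+ i <= 2.
Proof.
suff -> : \sum_(i < n) (2^-1 : R) ^+ i = 2 - 2 * 2^-1 ^+ n.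
  by rewrite gerBl mulr_ge0 // exprn_ge0 // invr_ge0.
elim: n => [|n IH]; first by rewrite big_ord0 expr0; ring.
by rewrite big_ord_recr /= IH exprS; field.
Qed.

(* A finite set of multi-indices sits in some cube [0, n)^d, over which the sum
   of 2^-|k| factors as the d-th power of a geometric sum. *)
Lemma sum_half_mdeg_le (s : seq (multiindex d)) : uniq s ->
  \sum_(k <- s) (2^-1 : R) ^+ mdeg k <= 2 ^+ d.
Proof.
move=> s_uniq; pose n := (\max_(k <- s) mdeg k)%N.
have lt_n k i : k \in s -> (k i < n.+1)%N.
  move=> ks; rewrite ltnS (leq_trans (leq_wt k i (fun=> ltn0Sn 0))) //.
  by rewrite -mdegE /n (bigD1_seq k) //= leq_maxl.
pose trunc k : {ffun 'I_d -> 'I_n.+1} := [ffun i => inord (k i)].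
pose lo (l : {ffun 'I_d -> 'I_n.+1}) : multiindex d := [ffun i => nat_of_ord (l i)].
have truncK : {in s, cancel trunc lo}.
  by move=> k ks; apply/ffunP => i; rewrite !ffunE inordK ?lt_n.
have mdeg_lo (l : {ffun 'I_d -> 'I_n.+1}) :
    (2^-1 : R) ^+ mdeg (lo l) = \prod_i 2^-1 ^+ l i.
  by rewrite -expr_sum; congr (_ ^+ _); apply: eq_bigr => i _; rewrite ffunE.
have -> : \sum_(k <- s) (2^-1 : R) ^+ mdeg k =
          \sum_(l <- map trunc s) 2^-1 ^+ mdeg (lo l).
  by rewrite big_map big_seq [RHS]big_seq; apply: eq_bigr => k ks; rewrite truncK.
rewrite big_uniq ?(map_inj_in_uniq (can_in_inj truncK)) //.
apply: (@le_trans _ _ (\sum_l (2^-1 : R) ^+ mdeg (lo l))).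
  rewrite [leRHS](bigID (mem (map trunc s))) /= lerDl sumr_ge0 //.
rewrite (eq_bigr _ (fun x _ => mdeg_lo x)).
rewrite -(bigA_distr_bigA (fun _ j => (2^-1 : R) ^+ nat_of_ord j)).
apply: (@le_trans _ _ (\prod_(i < d) 2)); last by rewrite prodr_const card_ord.
apply: ler_prod => i _; rewrite sum_geometric_half andbT sumr_ge0 //.
Qed.

(** Cauchy estimates: convergence on a polydisc amounts to geometric growth of the coefficients, a
    form that passes easily to differences and products. *)
Lemma germsP f : germs R d f <->
  exists C M : R, 0 < M /\ forall k, Normc.normc (f k) <= C * M ^+ mdeg k.
Proof.
split=> [[rho rho0 sf]|[C [M [M0 fle]]]].
  pose F k := (Normc.normc (f k) * rho ^+ mdeg k)%:E.
  have := sf; rewrite summableE => sfin.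
  exists (fine (\esum_(k in [set: multiindex d]) `|F k|)%E), rho^-1.
  split; [by rewrite invr_gt0|move=> k].
  rewrite exprVn ler_pdivlMr ?exprn_gt0 // -lee_fin fineK //.
  rewrite -[leLHS]gee0_abs ?lee_fin ?mulr_ge0 ?normc_ge0 ?exprn_ge0 ?(ltW rho0) //.
  apply: esum_ge; exists [set k]; first by split.
  by rewrite fsbig_set1.
have C0 : 0 <= C.
  have := fle 0; rewrite mdegE wt0 expr0 mulr1; exact: le_trans (normc_ge0 _).
(* With this radius the term at [k] is at most [C * 2^-1 ^+ mdeg k], and finite sums of these stay
   below [C * 2 ^+ d]. *)
exists (2^-1 / M); first by rewrite divr_gt0 // invr_gt0.
apply: (@le_lt_trans _ _ (C * 2 ^+ d)%:E); last exact: ltry.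
apply: ge_ereal_sup => _ [X [finX _] <-].
have term_ge0 k : (0 <= (Normc.normc (f k) * (2^-1 / M) ^+ mdeg k)%:E)%E.
  by rewrite lee_fin mulr_ge0 ?normc_ge0 ?exprn_ge0 // divr_ge0 ?(ltW M0).
rewrite fsbig_finite // (eq_bigr _ (fun k _ => gee0_abs (term_ge0 k))).
rewrite sumEFin lee_fin.
apply: (@le_trans _ _ (\sum_(k <- finmap.enum_fset (fset_set X)) (C * 2^-1 ^+ mdeg k))).
  apply: ler_sum => k _; rewrite expr_div_n mulrA ler_pdivrMr ?exprn_gt0 //.
  by rewrite mulrAC ler_wpM2r.
rewrite -mulr_sumr ler_wpM2l //; exact/sum_half_mdeg_le/finmap.fset_uniq.
Qed.

Lemma germs_restrict P f : germs R d f -> germs R d (series_restrict P f).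
Proof.
move=> /germsP[C [M [M0 fle]]]; apply/germsP; exists C, M; split=> // k.
rewrite /series_restrict; case: (P k) => //.
by rewrite Normc.normc0 (le_trans (normc_ge0 _) (fle k)).
Qed.

Lemma germs_common_bound f g : germs R d f -> germs R d g ->
  exists C M : R, [/\ 0 <= C, 0 < M,
    forall k, Normc.normc (f k) <= C * M ^+ mdeg k &
    forall k, Normc.normc (g k) <= C * M ^+ mdeg k].
Proof.
move=> /germsP[C [M [M0 fle]]] /germsP[C' [M' [M'0 gle]]].
have ge0 (F : power_series R d) K L :
    (forall k, Normc.normc (F k) <= K * L ^+ mdeg k) -> 0 <= K.
  by move=> /(_ 0); rewrite mdegE wt0 expr0 mulr1; exact: le_trans (normc_ge0 _).
have C0 := ge0 _ _ _ fle; have C'0 := ge0 _ _ _ gle.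
exists (Num.max C C'), (Num.max M M'); split; rewrite ?le_max ?lt_max ?C0 ?M0 // => k.
  apply: le_trans (fle k) _; rewrite ler_pM ?exprn_ge0 ?le_max ?lexx ?(ltW M0) //.
  by rewrite lerXn2r ?nnegrE ?le_max ?lexx ?(ltW M0).
apply: le_trans (gle k) _; rewrite ler_pM ?exprn_ge0 ?le_max ?lexx ?orbT ?(ltW M'0) //.
by rewrite lerXn2r ?nnegrE ?le_max ?lexx ?(ltW M0) ?(ltW M'0) ?orbT.
Qed.

Lemma germsB f g : germs R d f -> germs R d g -> germs R d (f - g).
Proof.
move=> gf gg; have [C [M [C0 M0 fle gle]]] := germs_common_bound gf gg.
apply/germsP; exists (C + C), M; split=> // k; rewrite mulrDl.
apply: le_trans (lerD (fle k) (gle k)).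
rewrite -(normcN (g k)); exact: le_normcD.
Qed.

Lemma germsD f g : germs R d f -> germs R d g -> germs R d (f + g).
Proof.
move=> gf gg; rewrite -[g]opprK; apply: germsB => //.
rewrite -sub0r; apply: germsB => //.
by apply/germsP; exists 0, 1; split=> // k; rewrite Normc.normc0 mul0r.
Qed.

(** Each term of the coefficient at [k] is at most C^2 M^|k|, and their number, the product of the
    k_i + 1, is at most 2^|k|; hence the rate [2 * M]. *)
Lemma germs_cauchy_mul f g :
  germs R d f -> germs R d g -> germs R d (cauchy_mul f g).
Proof.
move=> gf gg; have [C [M [C0 M0 fle gle]]] := germs_common_bound gf gg.
apply/germsP; exists (C * C), (2 * M); split=> [|k]; first exact: mulr_gt0.
apply: le_trans (normc_sum _ _ _) _.
apply: (@le_trans _ _ (\sum_(l : {dffun forall i : 'I_d, 'I_(k i).+1})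
    (C * C * M ^+ mdeg k))).
  apply: ler_sum => l _; rewrite Normc.normcM.
  apply: le_trans (ler_pM (normc_ge0 _) (normc_ge0 _) (fle _) (gle _)) _.
  by rewrite mulrACA -exprD -[in leRHS](box_split l) !mdegE wtD.
rewrite sumr_const -[leLHS]mulr_natr exprMn -[leLHS]mulrA ler_wpM2l ?mulr_ge0 //.
rewrite [leLHS]mulrC ler_wpM2r ?exprn_ge0 ?(ltW M0) // -natrX ler_nat.
rewrite card_dep_ffun foldrE big_map big_enum /= expn_sum; apply: leq_prod => i _.
by rewrite card_ord ltn_expl.
Qed.

End CauchyProduct.

(** * Linear algebra of weight vectors *)

(** By rank-nullity the kernel is a line. It serves to compare two linear forms that are constant on
    a facet. *)
Lemma rows_kernel_line (F : fieldType) n (M : 'M[F]_(n, n.+1)) (u v : 'rV[F]_n.+1) :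
  row_free M -> M *m u^T = 0 -> M *m v^T = 0 -> u != 0 ->
  exists t, v = t *: u.
Proof.
move=> free Mu Mv u0.
have in_ker (w : 'rV[F]_n.+1) : M *m w^T = 0 -> (w <= kermx M^T)%MS.
  by move=> Mw; apply/sub_kermxP; rewrite -[w]trmxK -trmx_mul Mw trmx0.
have rk : \rank (kermx M^T) = 1%N.
  by rewrite mxrank_ker mxrank_tr (eqP free) subSnn.
have := in_ker _ Mv; rewrite -(_ : (u :=: kermx M^T)%MS) => [/sub_rVP //|].
by apply/eqmxP; rewrite -(geq_leqif (mxrank_leqif_eq (in_ker _ Mu))) rk rank_rV u0.
Qed.

Section Dot.
Variables (R : realType) (d : nat).
Implicit Types (c x y : 'rV[R]_d) (k : multiindex d).

Lemma dotDr c x y : dot c (x + y) = dot c x + dot c y.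
Proof. by rewrite /dot -big_split; apply: eq_bigr => i _; rewrite mxE mulrDr. Qed.

Lemma dotZr c (t : R) x : dot c (t *: x) = t * dot c x.
Proof. by rewrite /dot mulr_sumr; apply: eq_bigr => i _; rewrite mxE mulrCA. Qed.

Lemma dotBr c x y : dot c (x - y) = dot c x - dot c y.
Proof. by rewrite dotDr -scaleN1r dotZr mulN1r. Qed.

Lemma dot_ge0 c x : (forall i, 0 <= c 0 i) -> orthant R d x -> 0 <= dot c x.
Proof. by move=> c0 x0; apply: sumr_ge0 => i _; rewrite mulr_ge0. Qed.

Definition weight_vector (a : 'I_d -> nat) : 'rV[R]_d := \row_i (a i)%:R.

Lemma dot_weight_vector a x : dot (weight_vector a) x = \sum_i (a i)%:R * x 0 i.
Proof. by apply: eq_bigr => i _; rewrite mxE. Qed.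

Lemma dot_exponent_point a k :
  dot (weight_vector a) (exponent_point R k) = (wt a k)%:R.
Proof.
by rewrite /wt natr_sum; apply: eq_bigr => i _; rewrite !mxE natrM.
Qed.

End Dot.

(** * The Newton polyhedron and half-spaces containing it *)

Section NewtonPolyhedron.
Variables (R : realType) (d : nat) (h : power_series R d).
Implicit Types (c x : 'rV[R]_d) (k : multiindex d) (a : 'I_d -> nat).

Local Notation NP := (newton_polyhedron h).

Lemma newton_polyhedronD k x :
  supp h k -> orthant R d x -> NP (exponent_point R k + x).
Proof.
move=> hk x0; apply: sub_gen_smallest; exists k => //; exists x => //.
Qed.

Lemma newton_polyhedron_exponent k : supp h k -> NP (exponent_point R k).
Proof.
by move=> hk; rewrite -[exponent_point R k]addr0; apply: newton_polyhedronD => // i;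
  rewrite mxE.
Qed.

(** The half-space is convex and contains the generators, since a form with nonnegative coefficients
    is nonnegative on the orthant. *)
Lemma newton_polyhedron_ge c (b : R) : (forall i, 0 <= c 0 i) ->
  (forall k, supp h k -> b <= dot c (exponent_point R k)) ->
  forall x, NP x -> b <= dot c x.
Proof.
move=> c0 hb; apply: smallest_sub => [x y t|_ [k hk [x x0 <-]]]; last first.
  by rewrite /= dotDr (le_trans (hb _ hk)) // lerDl dot_ge0.
rewrite !inE /= => bx b_y.
rewrite -[conv _ _ _]/(t%:num *: (x : 'rV[R]_d) + (1 - t%:num) *: (y : 'rV[R]_d)).
rewrite dotDr !dotZr -[b](_ : t%:num * b + (1 - t%:num) * b = b); last first.
  by ring.
by rewrite lerD // ler_wpM2l // subr_ge0.
Qed.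

End NewtonPolyhedron.

(** * Facets as loci of minimal weight *)

Section Facets.
Variable R : realType.

Lemma rows_mul_tr d n (q : 'I_n -> 'rV[R]_d) (c : 'rV[R]_d) :
  (\matrix_(i < n) q i) *m c^T = \col_i dot c (q i).
Proof.
by apply/matrixP => i j; rewrite !mxE; apply: eq_bigr => l _;
  rewrite !mxE mulrC (ord1 j).
Qed.

(** The exponent [k] and its translates by the unit vectors have the identity as matrix of
    differences. This excludes that a facet is the whole polyhedron. *)
Lemma newton_polyhedron_full_dim d (h : power_series R d) k : supp h k ->
  exists p : 'I_d.+1 -> 'rV[R]_d,
    (forall i, newton_polyhedron h (p i)) /\ affinely_independent p.
Proof.
move=> hk; exists (fun i => exponent_point R k +
  if unlift ord0 i is Some j then delta_mx 0 j else 0); split=> [i|].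
  apply: newton_polyhedronD => // j; case: unliftP => [l _|_]; rewrite !mxE //=.
rewrite /affinely_independent.
rewrite (_ : matrix_of_fun _ _ = 1%:M) ?row_free_unit ?unitmx1 //.
apply/row_matrixP => i; rewrite rowK row1 liftK unlift_none addr0.
by rewrite addrC addKr.
Qed.

(** The supporting form [c] and the weight form of [a] are both constant on [n + 1] affinely
    independent points of the facet, so [c] is [t] times the weight vector. Once [t > 0] is known,
    the facet is where the weight is minimal on the polyhedron. *)
Lemma newton_facetE n (h : power_series R n.+1) tau a k0 :
  supp h k0 -> newton_facets h tau -> primitive_normal tau a ->
  exists N : nat, [/\ forall k, supp h k -> (N <= wt a k)%N,
    exists2 k, supp h k & wt a k = N &
    tau = newton_polyhedron h `&` [set x | dot (weight_vector R a) x = N%:R]].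
Proof.
move=> hk0 [[c [b [bP tauE]]] _ [[p [tau_p free]] no_more]] [a_gt0 _ [N0 tauN0]].
pose av := weight_vector R a.
have dot_c x : tau x -> dot c x = b by rewrite tauE => -[].
have dot_a x : tau x -> dot av x = N0.
  by move/tauN0; rewrite /= dot_weight_vector.
have diff_orth (e : 'rV[R]_n.+1) (B : R) : (forall x, tau x -> dot e x = B) ->
    (\matrix_(i < n) (p (lift ord0 i) - p ord0)) *m e^T = 0.
  move=> eB; rewrite rows_mul_tr; apply/colP => i; rewrite !mxE dotBr.
  by rewrite !eB // subrr.
have av_neq0 : av != 0.
  apply/eqP => /rowP/(_ 0); rewrite !mxE => /eqP; rewrite pnatr_eq0.
  by rewrite -[_ == _]negbK -lt0n a_gt0.
have [t cE] := rows_kernel_line free (diff_orth _ _ dot_a) (diff_orth _ _ dot_c) av_neq0.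
have dotE x : dot c x = t * dot av x.
  by rewrite cE /dot mulr_sumr; apply: eq_bigr => i _; rewrite mxE mulrA.
(* For [t = 0] the face would be the whole polyhedron, whose dimension is too large. *)
have t_neq0 : t != 0.
  apply/eqP => t0; apply: no_more.
  have [q [Pq q_free]] := newton_polyhedron_full_dim hk0.
  exists q; split=> // i; rewrite tauE; split=> //=.
  by rewrite -(dot_c _ (tau_p ord0)) !dotE t0 !mul0r.
have t_gt0 : 0 < t.
  rewrite lt_def t_neq0 leNgt; apply/negP => t_lt0.
  (* Chosen so that [t * s] is -(|b| + 1): the form [c] is at most 0 at the exponent [k0], and
     moving by [s] along the first axis brings it below -|b|, hence below [b]. *)
  pose s := (`|b| + 1) / (- t).
  have s_ge0 : 0 <= s by rewrite divr_ge0 ?oppr_ge0 ?(ltW t_lt0) ?addr_ge0.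
  pose e : 'rV[R]_n.+1 := s *: delta_mx 0 0.
  have e_orthant : orthant R n.+1 e.
    by move=> i; rewrite !mxE mulr_ge0.
  have av_e : dot av e = s * (a 0)%:R.
    rewrite dotZr /dot (bigD1 0) //= big1 => [|i /negPf i0]; last first.
      by rewrite !mxE i0 andbF mulr0.
    by rewrite !mxE !eqxx mulr1 addr0.
  have := bP _ (newton_polyhedronD hk0 e_orthant).
  rewrite dotE dotDr dot_exponent_point av_e mulrDr mulrA.
  have -> : t * s = - (`|b| + 1) by rewrite /s; field.
  have w_le0 : t * (wt a k0)%:R <= 0 by rewrite mulr_le0_ge0 // ltW.
  have a0_ge1 : 1 <= (a 0)%:R :> R by rewrite (ler_nat R 1).
  have b_le := ler_norm (- b); rewrite normrN in b_le.
  have nb := normr_ge0 b.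
  move=> b_le'.
  have : `|b| + 1 <= (`|b| + 1) * (a 0)%:R by rewrite ler_peMr // addr_ge0.
  by lra.
have N0_le x : newton_polyhedron h x -> N0 <= dot av x.
  move=> /bP; rewrite -(dot_c _ (tau_p ord0)) !dotE ler_pM2l //.
  by rewrite dot_a.
have exN : exists N, `[< exists2 k, supp h k & wt a k = N >].
  by exists (wt a k0); apply/asboolP; exists k0.
case: (ex_minnP exN) => N /asboolP[k hk kN] N_min.
have N_le l : supp h l -> (N <= wt a l)%N.
  by move=> hl; apply: N_min; apply/asboolP; exists l.
have N_leP x : newton_polyhedron h x -> N%:R <= dot av x.
  apply: newton_polyhedron_ge => [i|l hl]; first by rewrite mxE.
  by rewrite dot_exponent_point ler_nat N_le.
(* Both numbers are the minimum of the weight on the polyhedron: [N0] is attained on the nonempty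
   facet, [N] at an exponent. *)
have NE : N0 = N%:R.
  apply: le_anti; rewrite -kN -dot_exponent_point N0_le //=; last first.
    exact: newton_polyhedron_exponent.
  rewrite dot_exponent_point kN -(dot_a _ (tau_p ord0)) N_leP //.
  by have := tau_p ord0; rewrite {1}tauE => -[].
exists N; split=> //; first by exists k.
apply/seteqP; split=> x.
  move=> tx; have := tx; rewrite {1}tauE => -[Px _]; split=> //=.
  by rewrite -NE dot_a.
case=> Px /= xN; rewrite tauE; split=> //=.
by rewrite -(dot_c _ (tau_p ord0)) !dotE xN dot_a ?NE.
Qed.

End Facets.

(** * Strict convexity and unique sums *)

(** For u = w + e and v = w - e the right-hand side is 2 w^2 + 2 e^2; the boolean records a gain of
    at least 1 when e is nonzero. *)
Lemma midpoint_sqr (u v w : nat) : (u + v = w + w)%N ->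
  (w ^ 2 + w ^ 2 + (u != v) <= u ^ 2 + v ^ 2)%N.
Proof.
rewrite -!mulnn; case: eqP => [|neq] uv; first nia.
by have [e|e] : (exists e, v = w + e.+1 /\ w = u + e.+1)%N \/
    (exists e, u = w + e.+1 /\ w = v + e.+1)%N;
  [case: (ltngtP u v) => ?; [left; exists (v - w).-1|right; exists (u - w).-1|]; lia| |];
  nia.
Qed.

(* A pair (k, m) maximising |k + m|^2 works: if k + m = l + q, then k + m is the
   midpoint of k + q and l + m, so strict convexity forces k + q = l + m. *)
Lemma unique_sum d (S T : set (multiindex d)) (B : nat) :
  (forall k, S k -> forall i, (k i <= B)%N) ->
  (forall m, T m -> forall i, (m i <= B)%N) ->
  S !=set0 -> T !=set0 ->
  exists k m, [/\ S k, T m &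
    forall l q, S l -> T q -> l + q = k + m -> l = k].
Proof.
move=> SB TB [k0 Sk0] [m0 Tm0].
pose sq (k : multiindex d) := (\sum_i k i ^ 2)%N.
pose P N := `[< exists k m, [/\ S k, T m & sq (k + m) = N] >].
have exP : exists N, P N.
  by exists (sq (k0 + m0)); apply/asboolP; exists k0, m0.
have P_le N : P N -> (N <= \sum_(i < d) (B + B) ^ 2)%N.
  move=> /asboolP[k [m [Sk Tm <-]]]; apply: leq_sum => i _.
  by rewrite ffunE leq_exp2r //; exact: leq_add (SB _ Sk _) (TB _ Tm _).
case: (ex_maxnP exP P_le) => N /asboolP[k [m [Sk Tm kmN]]] N_max.
have sq_le k' m' : S k' -> T m' -> (sq (k' + m')%R <= sq (k + m)%R)%N.
  by move=> Sk' Tm'; rewrite kmN N_max //; apply/asboolP; exists k', m'.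
exists k, m; split=> // l q Sl Tq lqkm.
have addE (x y : multiindex d) j : (x + y)%R j = (x j + y j)%N by rewrite ffunE.
have coord i : (l i + q i = k i + m i)%N.
  by rewrite -!addE lqkm.
apply/eqP; apply: contraT => l_neq_k.
have [i l_neq_ki] : exists i, l i != k i.
  apply/existsP; apply: contraR l_neq_k => /existsPn same.
  by apply/eqP/ffunP => i; apply/eqP; rewrite -[_ == _]negbK same.
(* Maximality bounds the sum of the two squared norms by twice the maximum, whereas coordinatewise
   convexity, strict at [i], makes it larger. *)
have := leq_add (sq_le _ _ Sk Tq) (sq_le _ _ Sl Tm).
rewrite leqNgt => /negP[]; rewrite /sq -!big_split /=.
have sqr_le j : ((k + m)%R j ^ 2 + (k + m)%R j ^ 2 + (l j != k j) <=
    (k + q)%R j ^ 2 + (l + m)%R j ^ 2)%N.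
  rewrite !addE.
  apply: leq_trans (@midpoint_sqr _ _ (k j + m j) _); last by have := coord j; lia.
  by rewrite leq_add2l; have := coord j; case: eqP; case: eqP => //=; lia.
rewrite (bigD1 i) //= [X in (_ < X)%N](bigD1 i) //= -addSn.
apply: leq_add; first by have := sqr_le i; rewrite l_neq_ki addn1.
by apply: leq_sum => j _; apply: leq_trans (sqr_le j); exact: leq_addr.
Qed.

(** * Lowest terms of products *)

Section LowestTerms.
Variables (R : realType) (d : nat).
Implicit Types (f h : power_series R d) (k m : multiindex d).

Definition min_weight h (a : 'I_d -> nat) (N : nat) : Prop :=
  (forall k, supp h k -> (N <= wt a k)%N) /\
  (exists2 k, supp h k & wt a k = N).

(** At a common point the weight [a1 + a2] equals [N1 + N2]. If no exponent attained both minima,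
    this weight would be at least [N1 + N2 + 1] on all exponents, hence on the polyhedron. *)
Lemma newton_polyhedron_meet h a1 a2 N1 N2 :
  min_weight h a1 N1 -> min_weight h a2 N2 ->
  (newton_polyhedron h `&` [set x | dot (weight_vector R a1) x = N1%:R]) `&`
  (newton_polyhedron h `&` [set x | dot (weight_vector R a2) x = N2%:R]) !=set0
  <-> exists k, [/\ supp h k, wt a1 k = N1 & wt a2 k = N2].
Proof.
move=> [N1_le _] [N2_le _]; split=> [[x [[Px x1] [_ x2]]]|[k [hk k1 k2]]]; last first.
  by exists (exponent_point R k); split; split;
    rewrite /= ?dot_exponent_point ?k1 ?k2 //; exact: newton_polyhedron_exponent.
apply: contrapT => no_k; pose a i := (a1 i + a2 i)%N.
have wtE k : wt a k = (wt a1 k + wt a2 k)%N.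
  by rewrite /wt -big_split; apply: eq_bigr => i _; rewrite mulnDl.
have dotE : dot (weight_vector R a) x = (N1 + N2)%:R.
  rewrite natrD -x1 -x2 /dot -big_split; apply: eq_bigr => i _.
  by rewrite !mxE natrD mulrDl.
have : (N1 + N2).+1%:R <= dot (weight_vector R a) x.
  apply: newton_polyhedron_ge Px => [i|k hk]; first by rewrite mxE.
  rewrite dot_exponent_point ler_nat wtE.
  have := N1_le _ hk; have := N2_le _ hk.
  case: (eqVneq (wt a1 k) N1) => [k1|]; last by lia.
  case: (eqVneq (wt a2 k) N2) => [k2|]; last by lia.
  by case: no_k; exists k.
by rewrite dotE ler_nat ltnn.
Qed.

(* The component of f * h of lowest bidegree for (a1, a2) is the product of the
   lowest components of f and h; a unique sum yields one nonzero coefficient. *)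
Lemma supp_cauchy_mul_low f h a1 a2 k0 m0 :
  (forall i, 0 < a1 i)%N ->
  supp f k0 -> supp h m0 ->
  (forall m, supp h m -> (wt a1 m0 <= wt a1 m)%N /\ (wt a2 m0 <= wt a2 m)%N) ->
  exists p, [/\ supp (cauchy_mul f h) p, (wt a1 p <= wt a1 (k0 + m0)%R)%N &
    (wt a2 p <= wt a2 (k0 + m0)%R)%N].
Proof.
move=> a1_gt0 fk0 hm0 m0_min.
(* Minimising the total weight below [k0] gives [k1] such that an exponent of [f] bounded by [k1] in
   both weights has the same two weights as [k1]. *)
pose P n := `[< exists k, [/\ supp f k, (wt a1 k <= wt a1 k0)%N,
  (wt a2 k <= wt a2 k0)%N & (wt a1 k + wt a2 k)%N = n] >].
have exP : exists n, P n by eexists; apply/asboolP; exists k0.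
case: (ex_minnP exP) => n /asboolP[k1 [fk1 k1_le1 k1_le2 k1n]] n_min.
pose S := [set k | supp f k /\ (wt a1 k = wt a1 k1 /\ wt a2 k = wt a2 k1)].
pose T := [set m | supp h m /\ (wt a1 m = wt a1 m0 /\ wt a2 m = wt a2 m0)].
have [k [m [[fk [k1E k2E]] [hm [m1E m2E]] km_unique]]] :
    exists k m, [/\ S k, T m & forall l q, S l -> T q -> l + q = k + m -> l = k].
  apply: (@unique_sum _ _ _ (wt a1 k1 + wt a1 m0)).
  - by move=> k [_ [<- _]] i; rewrite (leq_trans (leq_wt k i a1_gt0)) ?leq_addr.
  - by move=> k [_ [<- _]] i; rewrite (leq_trans (leq_wt k i a1_gt0)) ?leq_addl.
  - by exists k1.
  - by exists m0.
exists (k + m); split; last 2 first.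
- by rewrite !wtD; lia.
- by rewrite !wtD; lia.
rewrite /supp /= cauchy_mul_single ?mulf_neq0 // => l q fl hq lq.
(* Both weights of [q] are at least those of [m0], so those of [l] are at most those of [k1].
   Minimality turns this into equalities, which put [l] in [S] and [q] in [T]. *)
have [q1 q2] := m0_min _ hq.
have := congr1 (wt a1) lq; have := congr1 (wt a2) lq; rewrite !wtD => lq2 lq1.
have : (n <= wt a1 l + wt a2 l)%N.
  by apply: n_min; apply/asboolP; exists l; split=> //; lia.
move=> n_le; apply: (km_unique l q) => //; split=> //; lia.
Qed.

(* f 0 multiplies the lowest a-homogeneous part of h, which is all that h
   contributes to f * h in weight N. *)
Lemma low_term_eq0 f h a N : (forall i, 0 < a i)%N -> min_weight h a N ->
  (forall k, supp (cauchy_mul f h) k -> (N < wt a k)%N) -> f 0 = 0.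
Proof.
move=> a_gt0 [N_le [m hm mN]] fh_gt; apply/eqP; apply: contraT => f0.
have : supp (cauchy_mul f h) (0 + m).
  rewrite /supp /= cauchy_mul_single ?mulf_neq0 // => l q fl hq lq.
  have := congr1 (wt a) lq; rewrite !wtD wt0 mN => wl.
  apply/ffunP => i; rewrite [RHS]ffunE; apply/eqP.
  rewrite -leqn0 (leq_trans (leq_wt l i a_gt0)) //.
  by have := N_le _ hq; lia.
by move/fh_gt; rewrite add0r mN ltnn.
Qed.

Lemma valuation_idealP r (a : 'I_r -> 'I_d -> nat) v f :
  valuation_ideal R a v f <->
  germs R d f /\ forall j k, supp f k -> v j <= (wt (a j) k)%:Z.
Proof.
by split=> -[gf vf]; split=> // j; [exact/monomial_valuation_ge/vf|
  apply/monomial_valuation_ge/vf].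
Qed.

Definition series_one : power_series R d := fun k => (k == 0)%:R.

Lemma supp_one k : supp series_one k -> k = 0.
Proof. by rewrite /supp /series_one /=; case: (k =P 0) => //; rewrite eqxx. Qed.

Lemma cauchy_mul1l h : cauchy_mul series_one h = h.
Proof.
apply/funext => k; rewrite -[in LHS](add0r k) cauchy_mul_single.
  by rewrite /series_one eqxx mul1r.
by move=> l q /supp_one.
Qed.

Lemma germs_one : germs R d series_one.
Proof.
apply/germsP; exists 1, 1; split=> // k; rewrite expr1n mulr1 /series_one.
by case: (k == 0); rewrite ?Normc.normc1 // Normc.normc0.
Qed.

End LowestTerms.

(** * Bi-stellarity and intersections of valuation ideals modulo [h] *)

Theorem proposition4 (R : realType) (d r : nat) (h : power_series R d)
    (tau : 'I_r -> set 'rV[R]_d) (a : 'I_r -> 'I_d -> nat)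
    (h_germ : germs R d h) (h_neq0 : h <> 0) (h_at_o : h 0 = 0)
    (r_ge1 : (1 <= r)%N)
    (tau_facets : set_bij [set: 'I_r] (newton_facets h) tau)
    (a_normal : forall j, primitive_normal (tau j) (a j)) :
  bi_stellar h <->
  (forall v1 v2 : 'I_r -> int,
     sum_set (valuation_ideal R a v1) (principal_ideal h) `&`
     sum_set (valuation_ideal R a v2) (principal_ideal h) =
     sum_set (valuation_ideal R a (fun j => Num.max (v1 j) (v2 j)))
             (principal_ideal h)).
Proof.
have [k0 hk0] : exists k, supp h k.
  apply: contrapT => no_k; apply: h_neq0; apply/funext => k.
  by apply/eqP; apply: contrapT => hk; apply: no_k; exists k; apply/negP.
(* In dimension 0 the only exponent is 0, so [h 0 = 0] would leave [h] without monomials. *)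
have [n dE] : exists n, d = n.+1.
  case: d h tau a h_germ h_neq0 h_at_o tau_facets a_normal k0 hk0
    => [|n]; last by exists n.
  move=> h _ _ _ _ h0 _ _ k0; rewrite /supp /= (_ : k0 = 0) ?h0 ?eqxx //.
  by apply/ffunP => -[].
subst d; have [tau_in _ tau_surj] := tau_facets.
have a_gt0 j : (forall i, 0 < a j i)%N by case: (a_normal j).
have facet_min j : exists N, min_weight h (a j) N /\
    tau j = newton_polyhedron h `&` [set x | dot (weight_vector R (a j)) x = N%:R].
  by have [N [? ? ?]] := newton_facetE hk0 (tau_in j I) (a_normal j); exists N.
have [N hN] := choice facet_min.
have N_min j : min_weight h (a j) (N j) by case: (hN j).
have N_le j k : supp h k -> (N j <= wt (a j) k)%N by case: (N_min j) => + _; exact.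
have meetE j1 j2 : tau j1 `&` tau j2 !=set0 <->
    exists k, [/\ supp h k, wt (a j1) k = N j1 & wt (a j2) k = N j2].
  by case: (hN j1) => m1 ->; case: (hN j2) => m2 ->; exact: newton_polyhedron_meet.
have mul_ge f j k : supp (cauchy_mul f h) k ->
    exists2 l, supp f l & (wt (a j) l + N j <= wt (a j) k)%N.
  move=> /supp_cauchy_mul[l [m [fl hm <-]]]; exists l => //.
  by rewrite wtD leq_add2l N_le.
split=> [stellar v1 v2|cap_eq]; last first.
  move=> _ _ /tau_surj[j1 _ <-] /tau_surj[j2 _ <-]; apply/meetE.
  apply: contrapT => no_k.
  pose P (k : multiindex n.+1) := (N j1 < wt (a j1) k)%N.
  (* Each tuple asks for one more than the minimum at one index; the value 0 elsewhere imposes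
     nothing, weights being natural numbers. *)
  pose v1 j : int := if j == j1 then (N j1).+1%:Z else 0.
  pose v2 j : int := if j == j2 then (N j2).+1%:Z else 0.
  pose g1 := series_restrict P h; pose g2 := - series_restrict (predC P) h.
  have g1E : g1 - h = g2 by exact: restrictBE.
  (* A monomial of [h] outside [P] has minimal weight for [a j1], so by [no_k] its weight for [a j2]
     is not minimal. *)
  have g2_gt k : supp g2 k -> (N j2 < wt (a j2) k)%N.
    rewrite suppN supp_restrict /= -leqNgt => -[k1 hk].
    rewrite ltn_neqAle N_le // andbT; apply/eqP => k2.
    by apply: no_k; exists k; split=> //; apply/eqP; rewrite eqn_leq k1 N_le.
  have germ0 : germs R n.+1 0 by rewrite -(subrr h); exact: germsB.
  have gg1 : germs R n.+1 g1 by exact: germs_restrict.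
  have gg2 : germs R n.+1 g2 by rewrite -g1E; exact: germsB.
  have : sum_set (valuation_ideal R a (fun j => Num.max (v1 j) (v2 j)))
      (principal_ideal h) g1.
    rewrite -cap_eq; split.
      exists g1.
        apply/valuation_idealP; split=> // j k.
        by rewrite supp_restrict /v1 => -[Pk _]; case: eqP => [->|].
      exists 0; last exact: addr0.
      by exists 0 => //; have := cauchy_mulBl h h h; rewrite !subrr.
    exists g2.
      apply/valuation_idealP; split=> // j k /g2_gt; rewrite /v2.
      by case: eqP => [->|].
    exists h; last by rewrite -g1E subrK.
    by exists (@series_one R n.+1); [exact: germs_one|exact: cauchy_mul1l].
  move=> [g' /valuation_idealP[_ g'_ge] [_ [f gf <-] fE]].
  have fhE : cauchy_mul f h = g1 - g' by rewrite -fE addrAC subrr add0r.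
  have f0 : f 0 = 0.
    apply: (low_term_eq0 (a_gt0 j1) (N_min j1)) => k.
    rewrite fhE => /suppB[|/(g'_ge j1)]; first by rewrite supp_restrict => -[].
    by rewrite ge_max /v1 eqxx => /andP[].
  (* Subtracting [h] replaces [g1] by [g2], so (f - 1) h = g2 - g' has only monomials of
     [a j2]-weight above [N j2]. *)
  have : (f - @series_one R n.+1) 0 = 0.
    apply: (low_term_eq0 (a_gt0 j2) (N_min j2)) => k.
    rewrite cauchy_mulBl cauchy_mul1l fhE addrAC g1E => /suppB[/g2_gt //|/(g'_ge j2)].
    by rewrite ge_max /v2 eqxx => /andP[].
  rewrite -[LHS]/(f 0 - @series_one R n.+1 0) f0 /series_one eqxx sub0r => /eqP.
  by rewrite oppr_eq0 oner_eq0.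
apply/seteqP; split=> g; last first.
  move=> [g' /valuation_idealP[gg' v_le] [q hq <-]].
  by split; exists g'; (try by exists q); apply/valuation_idealP;
    split=> // j k /(v_le j);
    rewrite ge_max => /andP[].
move=> [[g1 /valuation_idealP[gg1 v1_le] [_ [f1 gf1 <-] g1E]]
        [g2 /valuation_idealP[gg2 v2_le] [_ [f2 gf2 <-] g2E]]].
pose f := f2 - f1.
have fhE : cauchy_mul f h = g1 - g2.
  rewrite cauchy_mulBl; apply/eqP; rewrite subr_eq addrAC eq_sym subr_eq g1E.
  by rewrite addrC g2E.
pose P (k : multiindex n.+1) :=
  [forall j, (v2 j <= v1 j) ==> (v1 j <= (wt (a j) k + N j)%:Z)].
pose A := series_restrict P f.
have gf : germs R n.+1 f by exact: germsB.
have gA : germs R n.+1 A by exact: germs_restrict.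
exists (g1 - cauchy_mul A h); last first.
  exists (cauchy_mul (A + f1) h); first by exists (A + f1) => //; exact: germsD.
  by rewrite cauchy_mulDl addrA subrK.
apply/valuation_idealP; split=> [|j k hk].
  by apply: germsB => //; exact: germs_cauchy_mul.
have [v21|v12] := leP (v2 j) (v1 j).
  case: (suppB hk) => [/v1_le//|/(mul_ge _ j)[l]].
  rewrite supp_restrict => -[/forallP/(_ j)]; rewrite v21 /= => v_le _ wl.
  by apply: le_trans v_le _; lia.
(* Where [v2 j] is the maximum, the second expression is used: [A - f] is minus the part of [f]
   outside [P]. *)
move: hk; have -> : g1 - cauchy_mul A h = g2 - cauchy_mul (A - f) h.
  rewrite cauchy_mulBl fhE opprB addrA [g2 + _]addrC subrK.
  by [].
case/suppB => [/v2_le//|/(mul_ge _ j)[l]].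
rewrite restrictBE suppN supp_restrict => -[/= nPl fl] wl.
move: nPl => /forallPn[j1]; rewrite negb_imply -ltNge => /andP[v21 lt_v1].
rewrite leNgt; apply/negP => lt_v2.
(* The exponent [l + m] breaks the [v1]-bound at [j1] and the [v2]-bound at [j]. So does the
   exponent [p] of [f h], which lies no higher in either weight. *)
have [|m [hm m1 m2]] := (meetE j1 j).1 _; first by apply: stellar; exact: tau_in.
have [|p [fhp p1 p2]] := @supp_cauchy_mul_low _ _ f h (a j1) (a j) l m (a_gt0 j1) fl hm.
  by move=> m' hm'; rewrite m1 m2 !N_le.
move: p1 p2; rewrite !wtD m1 m2 => p1 p2; move: fhp; rewrite fhE.
by case/suppB => [/(v1_le j1)|/(v2_le j)]; lia.
Qed.
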